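(* The least fixed point of $\Gamma:\operatorname{Idl}(\mathcal D_T)\to\operatorname{Idl}(\mathcal D_T)$ (the least, under inclusion, among all Turing ideals $I$ with $\Gamma(I)=I$) is $$\operatorname{ARITH}=\bigcup_{n<\omega}\downarrow\mathbf 0^{(n)},$$ where $\operatorname{ARITH}$ denotes the Turing ideal of arithmetical degrees, i.e. the set of Turing degrees of arithmetical subsets of $\omega$.
   Context: Let $\mathcal D_T$ be the poset of Turing degrees under Turing reducibility $\leq_T$, with least degree $\mathbf 0$, join $\mathbf a\vee\mathbf b=\deg_T(A\oplus B)$ and Turing jump $\mathbf a\mapsto\mathbf a'$. Put $\mathbf 0^{(0)}=\mathbf 0$ and $\mathbf 0^{(n+1)}=(\mathbf 0^{(n)})'$. A Turing ideal is a nonempty subset $I\subseteq\mathcal D_T$ that is closed downward under $\leq_T$ and closed under $\vee$; $\operatorname{Idl}(\mathcal D_T)$ is the set of Turing ideals ordered by inclusion. For a degree $\mathbf a$, $\downarrow\mathbf a=\{\mathbf b:\mathbf b\leq_T\mathbf a\}$, and for a set $S$ of degrees, $\downarrow S=\{\mathbf b:\exists\mathbf s\in S\ (\mathbf b\leq_T\mathbf s)\}$. The operator $\Gamma$ is $\Gamma(I)=\downarrow\{\mathbf a':\mathbf a\in I\}$. *)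

(* Defs.v *)
From HB Require Import structures.
From mathcomp Require Import all_boot zify.
From mathcomp Require Import boolp classical_sets.
From Stdlib Require Cantor.

Set Implicit Arguments.
Unset Strict Implicit.
Unset Printing Implicit Defensive.

Local Open Scope classical_set_scope.
Local Open Scope quotient_scope.

Definition npair (x y : nat) : nat := Cantor.to_nat (x, y).
Definition nfst (n : nat) : nat := (Cantor.of_nat n).1.
Definition nsnd (n : nat) : nat := (Cantor.of_nat n).2.

(* Programs for unary partial functions on nat that are recursive in an oracle.
   Several arguments are passed as one number through the Cantor pairing, which
   is itself computable; the class of unary functions obtained is therefore the
   usual one (zero, successor, projections, oracle, composition, primitive
   recursion, minimization). *)
Inductive code : Type :=
| CZero | CSucc | CFst | CSnd | COracle
| CPair of code & code
| CComp of code & code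
| CRec of code & code
| CMu of code.

(* [eval A c x y]: program c with oracle A halts on input x with output y.
   CMu c maps <a, n> to the least m >= n such that c vanishes at <a, m>,
   provided c is defined at <a, n>, ..., <a, m>. *)
Inductive eval (A : set nat) : code -> nat -> nat -> Prop :=
| eval_zero x : eval A CZero x 0
| eval_succ x : eval A CSucc x x.+1
| eval_fst x : eval A CFst x (nfst x)
| eval_snd x : eval A CSnd x (nsnd x)
| eval_oracle x : eval A COracle x (nat_of_bool `[< A x >])
| eval_pair c d x y z :
    eval A c x y -> eval A d x z -> eval A (CPair c d) x (npair y z)
| eval_comp c d x y z :
    eval A d x y -> eval A c y z -> eval A (CComp c d) x z
| eval_rec0 c d a y :
    eval A c a y -> eval A (CRec c d) (npair a 0) y
| eval_recS c d a n y z :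
    eval A (CRec c d) (npair a n) y ->
    eval A d (npair a (npair n y)) z ->
    eval A (CRec c d) (npair a n.+1) z
| eval_mu0 c a n :
    eval A c (npair a n) 0 -> eval A (CMu c) (npair a n) n
| eval_muS c a n v m :
    eval A c (npair a n) v.+1 ->
    eval A (CMu c) (npair a n.+1) m ->
    eval A (CMu c) (npair a n) m.

(* Goedel numbering; by [encode_bij] every number is the index of exactly one
   program. *)
Fixpoint encode (c : code) : nat :=
  match c with
  | CZero => 0
  | CSucc => 1
  | CFst => 2
  | CSnd => 3
  | COracle => 4
  | CPair c d => 5 + 4 * npair (encode c) (encode d)
  | CComp c d => 6 + 4 * npair (encode c) (encode d)
  | CRec c d => 7 + 4 * npair (encode c) (encode d)
  | CMu c => 8 + 4 * encode c
  end.

Lemma npair_inj x y x' y' : npair x y = npair x' y' -> x = x' /\ y = y'.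
Proof. by move=> /Cantor.to_nat_inj[]. Qed.

Lemma npairK n : npair (nfst n) (nsnd n) = n.
Proof.
rewrite /npair /nfst /nsnd; have := Cantor.cancel_to_of n.
by case: (Cantor.of_nat n).
Qed.

Lemma npair_ge x y : y + x <= npair x y.
Proof. by apply/leP; exact: Cantor.to_nat_non_decreasing. Qed.

Lemma encode_inj : injective encode.
Proof.
elim=> [|||||c IHc d IHd|c IHc d IHd|c IHc d IHd|c IHc];
  case=> [|||||c' d'|c' d'|c' d'|c'] //= E; try lia.
- have /npair_inj[/IHc-> /IHd->//] :
    npair (encode c) (encode d) = npair (encode c') (encode d') by lia.
- have /npair_inj[/IHc-> /IHd->//] :
    npair (encode c) (encode d) = npair (encode c') (encode d') by lia.
- have /npair_inj[/IHc-> /IHd->//] :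
    npair (encode c) (encode d) = npair (encode c') (encode d') by lia.
- by have /IHc-> : encode c = encode c' by lia.
Qed.

Lemma encode_surj n : exists c, encode c = n.
Proof.
elim/ltn_ind: n => n IH.
have [n5|n5] := ltnP n 5.
  case: n n5 {IH} => [|[|[|[|[|//]]]]] _;
    [by exists CZero|by exists CSucc|by exists CFst|by exists CSnd|
     by exists COracle].
pose q := (n - 5) %/ 4; have ltqn : q < n by rewrite /q; lia.
have := npair_ge (nfst q) (nsnd q); rewrite npairK => leq.
have [c Ec] : exists c, encode c = nfst q by apply: IH; lia.
have [d Ed] : exists d, encode d = nsnd q by apply: IH; lia.
have [e Ee] := IH q ltqn.
have [r4 | [r4 | [r4 | r4]]] : (n = 5 + 4 * q) \/ (n = 6 + 4 * q) \/
    (n = 7 + 4 * q) \/ (n = 8 + 4 * q) by rewrite /q; lia.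
- by exists (CPair c d); rewrite /= Ec Ed npairK r4.
- by exists (CComp c d); rewrite /= Ec Ed npairK r4.
- by exists (CRec c d); rewrite /= Ec Ed npairK r4.
- by exists (CMu e); rewrite /= Ee r4.
Qed.

Lemma encode_bij n : exists! c, encode c = n.
Proof.
have [c Ec] := encode_surj n; exists c; split=> // d Ed.
by apply: encode_inj; rewrite Ec Ed.
Qed.

Definition turing_le (A B : set nat) : Prop :=
  exists c, forall x, eval B c x (nat_of_bool `[< A x >]).

Definition turing_eq (A B : set nat) : Prop := turing_le A B /\ turing_le B A.

Definition turing_join (A B : set nat) : set nat :=
  [set n | if odd n then B n./2 else A n./2].

Definition turing_jump (A : set nat) : set nat :=
  [set e | exists c y, encode c = e /\ eval A c e y].

Lemma turing_le_refl A : turing_le A A.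
Proof. by exists COracle => x; exact: eval_oracle. Qed.

Fixpoint oracle_subst (d c : code) : code :=
  match c with
  | COracle => d
  | CPair c1 c2 => CPair (oracle_subst d c1) (oracle_subst d c2)
  | CComp c1 c2 => CComp (oracle_subst d c1) (oracle_subst d c2)
  | CRec c1 c2 => CRec (oracle_subst d c1) (oracle_subst d c2)
  | CMu c1 => CMu (oracle_subst d c1)
  | c => c
  end.

Lemma eval_oracle_subst A B d c x y :
  (forall z, eval B d z (nat_of_bool `[< A z >])) ->
  eval A c x y -> eval B (oracle_subst d c) x y.
Proof. by move=> Bd; elim=> * //=; econstructor; eauto. Qed.

Lemma turing_le_trans A B C :
  turing_le A B -> turing_le B C -> turing_le A C.
Proof.
move=> [c Ac] [d Bd]; exists (oracle_subst d c) => x.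
exact: eval_oracle_subst (Bd) (Ac x).
Qed.

Definition turing_eqb (A B : set nat) : bool := `[< turing_eq A B >].

Lemma turing_eqb_refl : reflexive turing_eqb.
Proof. by move=> A; apply/asboolP; split; exact: turing_le_refl. Qed.

Lemma turing_eqb_sym : symmetric turing_eqb.
Proof. by move=> A B; apply/asboolP/asboolP => -[]. Qed.

Lemma turing_eqb_trans : transitive turing_eqb.
Proof.
move=> B A C /asboolP[AB BA] /asboolP[BC CB]; apply/asboolP.
by split; [exact: turing_le_trans AB BC|exact: turing_le_trans CB BA].
Qed.

Canonical turing_equiv :=
  EquivRel turing_eqb turing_eqb_refl turing_eqb_sym turing_eqb_trans.

Definition degree : Type := {eq_quot turing_equiv}.

Definition deg (A : set nat) : degree := \pi_({eq_quot turing_equiv}) A.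

Definition degree_repr (a : degree) : set nat :=
  repr (a : {eq_quot turing_equiv}).

(* Operations on degrees are computed on chosen representatives; they do not
   depend on this choice since the operations on sets respect [turing_eq]. *)
Definition degree_le (a b : degree) : Prop :=
  turing_le (degree_repr a) (degree_repr b).

Definition degree_join (a b : degree) : degree :=
  deg (turing_join (degree_repr a) (degree_repr b)).

Definition degree_jump (a : degree) : degree :=
  deg (turing_jump (degree_repr a)).

Lemma degree_reprK a : deg (degree_repr a) = a.
Proof. exact: reprK. Qed.

Lemma degP A B : deg A = deg B <-> turing_eq A B.
Proof.
split; first by move/eqmodP/asboolP.
by move=> AB; apply/eqmodP/asboolP.
Qed.

Lemma degree_leE A B : degree_le (deg A) (deg B) <-> turing_le A B.
Proof.
have [A1 A2] : turing_eq (degree_repr (deg A)) A.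
  by apply/degP; rewrite degree_reprK.
have [B1 B2] : turing_eq (degree_repr (deg B)) B.
  by apply/degP; rewrite degree_reprK.
split=> AB.
  exact: turing_le_trans A2 (turing_le_trans AB B1).
exact: turing_le_trans A1 (turing_le_trans AB B2).
Qed.

Definition zero_jump (n : nat) : degree := iter n degree_jump (deg set0).

Definition lower_cone (a : degree) : set degree := [set b | degree_le b a].

Definition down_closure (S : set degree) : set degree :=
  [set b | exists2 s, S s & degree_le b s].

Definition turing_ideal (I : set degree) : Prop :=
  [/\ I !=set0,
      forall a b, I a -> degree_le b a -> I b
    & forall a b, I a -> I b -> I (degree_join a b)].

Definition Gamma (I : set degree) : set degree :=
  down_closure [set degree_jump a | a in I].

(* First-order arithmetic in the language 0, S, +, *, =, with de Bruijn
   variables: TVar i is the i-th entry of the environment and FEx binds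
   variable 0. *)
Inductive term : Type :=
| TVar of nat
| TZero
| TSucc of term
| TAdd of term & term
| TMul of term & term.

Inductive formula : Type :=
| FEq of term & term
| FNot of formula
| FAnd of formula & formula
| FEx of formula.

Fixpoint term_val (rho : seq nat) (t : term) : nat :=
  match t with
  | TVar i => nth 0 rho i
  | TZero => 0
  | TSucc t => (term_val rho t).+1
  | TAdd t u => term_val rho t + term_val rho u
  | TMul t u => term_val rho t * term_val rho u
  end.

Fixpoint sat (rho : seq nat) (f : formula) : Prop :=
  match f with
  | FEq t u => term_val rho t = term_val rho u
  | FNot f => ~ sat rho f
  | FAnd f g => sat rho f /\ sat rho g
  | FEx f => exists n, sat (n :: rho) f
  end.

(* Stray free variables of f denote 0, hence do not act as parameters. *)
Definition arithmetical (A : set nat) : Prop :=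
  exists f, forall n, A n <-> sat [:: n] f.

Definition ARITH : set degree := [set deg A | A in arithmetical].

(* Main.v *)
(** The jump is monotone for Turing reducibility because substituting a program
    for the oracle acts computably on indices, so [Gamma] preserves ideals and
    [0^(n)] is the degree of the [n]-th jump of the empty set. A formula with
    [n] quantifiers defines a set recursive in the [n]-th jump, since an
    existential quantifier over a set recursive in [A] is recursive in [A'].
    Conversely arithmetical sets are closed under the jump and under Turing
    reducibility, since [eval A] is arithmetical in [A]: a computation is a
    finite set of true statements "program e maps x to y", each of which follows
    from the others by one evaluation rule, and finite sets of numbers are coded
    by divisibility as in Goedel's beta function. *)
Require Import Defs.
From mathcomp Require Import all_boot zify.
From mathcomp Require Import boolp classical_sets.
From Stdlib Require Cantor.

Set Implicit Arguments.
Unset Strict Implicit.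
Unset Printing Implicit Defensive.

Local Open Scope classical_set_scope.

(** * Pairing, inversion of evaluation, and determinism *)

Lemma nfst_pair x y : nfst (npair x y) = x.
Proof. by rewrite /nfst /npair Cantor.cancel_of_to. Qed.

Lemma nsnd_pair x y : nsnd (npair x y) = y.
Proof. by rewrite /nsnd /npair Cantor.cancel_of_to. Qed.

Lemma npair_double x y :
  npair x y + npair x y = y + y + (x + y) * (x + y).+1.
Proof.
have := Cantor.to_nat_spec x y; rewrite -/(npair x y); lia.
Qed.

(** [npair a n] is not a constructor pattern, so plain inversion does not recover [a] and [n]; the
    input is generalized and then split by injectivity of pairing. *)
Lemma eval_recE A c d a n z :
  eval A (CRec c d) (npair a n) z ->
  match n with
  | 0 => eval A c a z
  | m.+1 => exists y, eval A (CRec c d) (npair a m) y /\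
                      eval A d (npair a (npair m y)) z
  end.
Proof.
move Ex: (npair a n) => x; move Ec: (CRec c d) => e H.
case: H Ex Ec => // [c' d' a' y H | c' d' a' m y w H1 H2]
  /npair_inj[? ?] [? ?]; subst=> //.
by exists y.
Qed.

Lemma eval_muE A c a n m :
  eval A (CMu c) (npair a n) m ->
  (m = n /\ eval A c (npair a n) 0) \/
  exists v, eval A c (npair a n) v.+1 /\ eval A (CMu c) (npair a n.+1) m.
Proof.
move Ex: (npair a n) => x; move Ec: (CMu c) => e H.
case: H Ex Ec => // [c' a' k H | c' a' k v w H1 H2] /npair_inj[? ?] [?]; subst.
  by left.
by right; exists v.
Qed.

Lemma eval_compE A c d x z :
  eval A (CComp c d) x z -> exists y, eval A d x y /\ eval A c y z.
Proof. by move=> H; inversion H; subst; eexists; split; eassumption. Qed.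

Lemma eval_det A c x y z : eval A c x y -> eval A c x z -> y = z.
Proof.
move=> H; elim: H z => {c x y}.
- by move=> x z H; inversion H.
- by move=> x z H; inversion H.
- by move=> x z H; inversion H.
- by move=> x z H; inversion H.
- by move=> x z H; inversion H.
- move=> c d x u v _ IHc _ IHd z H; inversion H; subst.
  by congr npair; [apply: IHc|apply: IHd].
- by move=> c d x u v _ IHd _ IHc z /eval_compE[w [/IHd <-]]; exact: IHc.
- by move=> c d a y _ IH z /eval_recE/IH.
- move=> c d a n y z _ IHr _ IHd w /eval_recE[u [/IHr <-]]; exact: IHd.
- by move=> c a n _ IH z /eval_muE[[->//]|[v [/IH]]].
- by move=> c a n v m _ IHc _ IH z /eval_muE[[-> /IHc]|[w [_ /IH]]].
Qed.

(** * Total functions computable in an oracle *)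

Definition computable_in (A : set nat) (F : nat -> nat) : Prop :=
  exists c, forall x, eval A c x (F x).

Section Computable.
Variable A : set nat.
Local Notation cin := (computable_in A).

Lemma cin_ext F G : F =1 G -> cin F -> cin G.
Proof. by move=> FG [c Hc]; exists c => x; rewrite -FG. Qed.

Lemma cin_comp F G : cin F -> cin G -> cin (fun x => F (G x)).
Proof.
move=> [c Hc] [d Hd]; exists (CComp c d) => x.
exact: eval_comp (Hd x) (Hc (G x)).
Qed.

Lemma cin_pair F G : cin F -> cin G -> cin (fun x => npair (F x) (G x)).
Proof. by move=> [c Hc] [d Hd]; exists (CPair c d) => x; exact: eval_pair. Qed.

Lemma cin_fst F : cin F -> cin (fun x => nfst (F x)).
Proof. by apply: cin_comp; exists CFst => x; exact: eval_fst. Qed.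

Lemma cin_snd F : cin F -> cin (fun x => nsnd (F x)).
Proof. by apply: cin_comp; exists CSnd => x; exact: eval_snd. Qed.

Lemma cin_succ F : cin F -> cin (fun x => (F x).+1).
Proof. by apply: cin_comp; exists CSucc => x; exact: eval_succ. Qed.

Lemma cin_id : cin id.
Proof.
exists (CPair CFst CSnd) => x; rewrite -{2}(npairK x).
by apply: eval_pair; constructor.
Qed.

Lemma cin_const n : cin (fun=> n).
Proof.
elim: n => [|n IH]; first by exists CZero => x; exact: eval_zero.
exact: cin_succ IH.
Qed.

(** General interface to [CRec]: [P] supplies the parameter and [Q] the number of steps, so a
    function is computable once its recursion equations are exhibited. *)
Lemma cin_rec (R : nat -> nat -> nat) (F : nat -> nat)
    (G : nat -> nat -> nat -> nat) P Q :
  (forall a, R a 0 = F a) -> (forall a n, R a n.+1 = G a n (R a n)) ->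
  cin F -> cin (fun z => G (nfst z) (nfst (nsnd z)) (nsnd (nsnd z))) ->
  cin P -> cin Q -> cin (fun x => R (P x) (Q x)).
Proof.
move=> R0 RS [c Hc] [d Hd] HP HQ.
suff [e He] : cin (fun z => R (nfst z) (nsnd z)).
  have := cin_comp (ex_intro (fun c => forall x, eval A c x _) e He)
    (cin_pair HP HQ).
  by apply: cin_ext => x; rewrite nfst_pair nsnd_pair.
exists (CRec c d) => z; rewrite -{1}(npairK z).
elim: (nsnd z) => [|n IH]; first by rewrite R0; apply: eval_rec0.
rewrite RS; apply: eval_recS IH _.
by have := Hd (npair (nfst z) (npair n (R (nfst z) n)));
  rewrite !(nfst_pair, nsnd_pair).
Qed.

Hint Resolve cin_id cin_const cin_pair cin_fst cin_snd cin_succ : cin.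

Lemma cin_if P F G : cin P -> cin F -> cin G ->
  cin (fun x => if P x == 0 then F x else G x).
Proof.
(* Branching is a recursion of length [P x] with parameter [x], whose step ignores the previous
   value. *)
move=> HP HF HG; pose R x n := if n == 0 then F x else G x.
apply: (cin_rec (R := R) (F := F) (G := fun a _ _ => G a)) => //; auto with cin.
by apply: cin_comp => //; auto with cin.
Qed.

Lemma cin_pred F : cin F -> cin (fun x => (F x).-1).
Proof.
move=> HF; pose R (_ n : nat) := n.-1.
by apply: (cin_rec (R := R) (F := fun=> 0) (G := fun _ n _ => n))
  cin_id HF; auto with cin.
Qed.

Lemma cin_add F G : cin F -> cin G -> cin (fun x => F x + G x).
Proof.
by apply: (cin_rec (R := addn) (F := id) (G := fun _ _ r => r.+1)) => [|a n||];
  rewrite ?addn0 ?addnS //; auto 6 with cin; exact: addn0.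
Qed.
Hint Resolve cin_add cin_pred : cin.

Lemma cin_sub F G : cin F -> cin G -> cin (fun x => F x - G x).
Proof.
apply: (cin_rec (R := subn) (F := id) (G := fun _ _ r => r.-1));
  auto 6 with cin; [exact: subn0|exact: subnS].
Qed.

Lemma cin_mul F G : cin F -> cin G -> cin (fun x => F x * G x).
Proof.
apply: (cin_rec (R := muln) (F := fun=> 0) (G := fun a _ r => a + r));
  auto 6 with cin; [exact: muln0|exact: mulnS].
Qed.
Hint Resolve cin_sub cin_mul : cin.

Lemma cin_odd F : cin F -> cin (fun x => nat_of_bool (odd (F x))).
Proof.
pose R (_ n : nat) := nat_of_bool (odd n) => HF.
apply: (cin_rec (R := R) (F := fun=> 0) (G := fun _ _ r => 1 - r)) cin_id HF;
  auto 6 with cin.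
by move=> a n; rewrite /R /=; case: odd.
Qed.
Hint Resolve cin_odd : cin.

Lemma cin_half F : cin F -> cin (fun x => (F x)./2).
Proof.
pose R (_ n : nat) := n./2 => HF.
apply: (cin_rec (R := R) (F := fun=> 0) (G := fun _ n r => odd n + r))
  cin_id HF; auto 7 with cin.
by move=> a n; rewrite /R /= uphalf_half.
Qed.

Lemma cin_iter_snd F G : cin F -> cin G ->
  cin (fun x => iter (F x) nsnd (G x)).
Proof.
move=> HF HG; pose R a n := iter n nsnd a.
by apply: (cin_rec (R := R) (F := id) (G := fun _ _ r => nsnd r)) HG HF => //;
  auto 6 with cin.
Qed.

End Computable.

#[local] Hint Resolve cin_id cin_const cin_pair cin_fst cin_snd cin_succ cin_if
  cin_pred cin_add cin_sub cin_mul cin_odd cin_half cin_iter_snd : cin.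

(** * Turing reducibility: Boolean operations and joins *)

Lemma turing_le_many_one (A B : set nat) F :
  computable_in B F -> (forall x, A x <-> B (F x)) -> turing_le A B.
Proof.
move=> HF AB.
have HB : computable_in B (fun x => nat_of_bool `[< B x >]).
  exact: turing_le_refl.
have [c Hc] := cin_comp HB HF; exists c => x.
by rewrite (asbool_equiv_eq (AB x)).
Qed.

Lemma turing_le_not (A B : set nat) : turing_le A B -> turing_le (~` A) B.
Proof.
move=> AB; have : computable_in B (fun x => 1 - nat_of_bool `[< A x >]).
  by auto with cin.
by apply: cin_ext => x; rewrite asbool_neg; case: asbool.
Qed.

Lemma turing_le_and (A C B : set nat) :
  turing_le A B -> turing_le C B -> turing_le (A `&` C) B.
Proof.
move=> AB CB.
have : computable_in B
    (fun x => nat_of_bool `[< A x >] * nat_of_bool `[< C x >]).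
  by auto with cin.
by apply: cin_ext => x; rewrite asbool_and mulnb.
Qed.

Lemma turing_le_set0 A : turing_le set0 A.
Proof.
by apply: (cin_ext (F := fun=> 0)) (cin_const _ _) => x; rewrite asboolF.
Qed.

Lemma turing_le_joinl A B : turing_le A (turing_join A B).
Proof.
apply: (turing_le_many_one (F := fun x => x + x)); first by auto with cin.
by move=> x; rewrite /turing_join /= addnn odd_double doubleK.
Qed.

Lemma turing_le_joinr A B : turing_le B (turing_join A B).
Proof.
apply: (turing_le_many_one (F := fun x => (x + x).+1)); first by auto with cin.
by move=> x; rewrite /turing_join /= addnn odd_double /= uphalf_double.
Qed.

Lemma turing_join_le A B C :
  turing_le A C -> turing_le B C -> turing_le (turing_join A B) C.
Proof.
move=> AC BC.
have HA : computable_in C (fun x => nat_of_bool `[< A x./2 >]).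
  exact: cin_comp AC (cin_half (cin_id _)).
have HB : computable_in C (fun x => nat_of_bool `[< B x./2 >]).
  exact: cin_comp BC (cin_half (cin_id _)).
have := cin_if (cin_odd (cin_id _)) HA HB.
by apply: cin_ext => x; rewrite /turing_join /=; case: odd.
Qed.

(** * The jump *)

Fixpoint const_code n :=
  if n is m.+1 then CComp CSucc (const_code m) else CZero.

Lemma eval_const_code A n x y : eval A (const_code n) x y <-> y = n.
Proof.
split=> [|->]; last by elim: n => [|n IH]; econstructor; eauto; constructor.
elim: n y => [|n IH] y; first by move=> H; inversion H.
by move=> /eval_compE[z [/IH-> H]]; inversion H.
Qed.

Lemma cin_const_code A F : computable_in A F ->
  computable_in A (fun x => encode (const_code (F x))).
Proof.
move=> HF; pose R (_ n : nat) := encode (const_code n).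
(* [6 + 4 * npair 1 r] is the index of the composition of [CSucc] with the program of index [r]. *)
by apply: (cin_rec (R := R) (F := fun=> 0) (G := fun _ _ r => 6 + 4 * npair 1 r))
  (cin_id _) HF; auto 9 with cin.
Qed.
#[local] Hint Resolve cin_const_code : cin.

(* The s-m-n theorem: [CComp (F x) (const_code x)] ignores its input and runs
   [F x] on [x]. *)
Lemma turing_le_jumpP (X A : set nat) (F : nat -> code) :
  computable_in (turing_jump A) (fun x => encode (F x)) ->
  (forall x, X x <-> exists y, eval A (F x) x y) ->
  turing_le X (turing_jump A).
Proof.
move=> HF XE.
apply: (turing_le_many_one (F := fun x => encode (CComp (F x) (const_code x)))).
  by rewrite /=; auto 9 with cin.
move=> x; rewrite XE; split=> [[y Fy]|].
  exists (CComp (F x) (const_code x)), y; split=> //.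
  by apply: eval_comp Fy; apply/eval_const_code.
move=> [c [y [/encode_inj-> /eval_compE[z [/eval_const_code-> H]]]]].
by exists y.
Qed.

Lemma eval_mu_total A c F a : (forall x, eval A c x (F x)) ->
  (exists m, eval A (CMu c) (npair a 0) m) <-> (exists m, F (npair a m) = 0).
Proof.
move=> HF; split=> [[m H]|].
  (* The starting point of the search becomes a variable, since the induction on the evaluation
     moves it. *)
  exists m; move: {1}0 H => i; move Ex: (npair a i) => x.
  move Ed: (CMu c) => d H.
  move: i Ex Ed; elim: H => // {d x m}.
    by move=> d b n H _ k /npair_inj[-> _] [?]; subst;
      apply: eval_det (HF _) H.
  by move=> d b n v m _ _ _ IH k /npair_inj[? _] [?]; subst; exact: (IH n.+1).
case=> m Fm.
(* Downward induction on the starting point from the zero [m]: a search either stops at once or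
   continues from the next number. *)
suff H k : exists i, eval A (CMu c) (npair a (m - k)) i.
  by have := H m; rewrite subnn.
elim: k => [|k [i Hi]].
  by exists m; rewrite subn0; apply: eval_mu0; rewrite -Fm.
have [mk|km] := leqP m k; first by exists i; have -> : m - k.+1 = m - k by lia.
have Emk : m - k = (m - k.+1).+1 by lia.
have := HF (npair a (m - k.+1)); case: (F _) => [|v] Hv.
  by exists (m - k.+1); exact: eval_mu0.
by exists i; apply: eval_muS Hv _; rewrite -Emk.
Qed.

(** An unbounded search for a witness halts exactly when a witness exists, and the jump decides
    halting. *)
Lemma turing_le_ex (R A : set nat) : turing_le R A ->
  turing_le [set x | exists n, R (npair n x)] (turing_jump A).
Proof.
move=> RA.
(* [CMu] looks for zeros and puts its counter second, so the characteristic function is negated and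
   the pair swapped. *)
have [c Hc] : computable_in A
    (fun z => 1 - nat_of_bool `[< R (npair (nsnd z) (nfst z)) >]).
  by apply: cin_sub; [auto with cin|apply: cin_comp RA _; auto with cin].
have [d Hd] : computable_in A (fun x => npair x 0) by auto with cin.
apply: (turing_le_jumpP (F := fun=> CComp (CMu c) d)); first exact: cin_const.
move=> x /=; split=> [[n Rn]|[y /eval_compE[z [Hz]]]];
  last rewrite -(eval_det (Hd x) Hz).
  have [|m Hm] := (eval_mu_total x Hc).2.
    by exists n; rewrite nfst_pair nsnd_pair; move/asboolP: Rn => ->.
  by exists m; apply: eval_comp (Hd x) Hm.
move=> H; have [n] := (eval_mu_total x Hc).1 (ex_intro _ y H).
rewrite nfst_pair nsnd_pair; case: asboolP => // Rn _; by exists n.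
Qed.

(** [A] is the projection of a set of pairs whose first coordinate is a dummy. *)
Lemma turing_le_jump A : turing_le A (turing_jump A).
Proof.
have H : turing_le [set z | A (nsnd z)] A.
  by apply: (turing_le_many_one (F := nsnd)) => //; auto with cin.
apply: turing_le_trans (turing_le_ex H).
apply: (turing_le_many_one (F := id)) (cin_id _) _ => x /=.
by split=> [Ax|[n]]; [exists 0|]; rewrite nsnd_pair.
Qed.

(** * Monotonicity of the jump through oracle substitution on indices *)

Lemma eval_oracle_substV A B d c x y :
  (forall z, eval B d z (nat_of_bool `[< A z >])) ->
  eval B (oracle_subst d c) x y -> eval A c x y.
Proof.
move=> Bd.
elim: c x y => [|||||c IHc e IHe|c IHc e IHe|c IHc e IHe|c IHc] x y /= H.
- by inversion H; constructor.
- by inversion H; constructor.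
- by inversion H; constructor.
- by inversion H; constructor.
- by rewrite (eval_det H (Bd x)); constructor.
- by inversion H; subst; apply: eval_pair; auto.
- by have [z [/IHe ? /IHc]] := eval_compE H; exact: eval_comp.
- move: H; rewrite -(npairK x); elim: (nsnd x) y => [|n IH] y /eval_recE.
    by move/IHc; exact: eval_rec0.
  by move=> [z [/IH Hz /IHe]]; exact: eval_recS.
(* A search has no structural measure, so this case goes by induction on the evaluation itself. *)
- move Ef: (CMu _) H => f H; elim: H Ef => // {f x y}.
    by move=> f a n H _ [E]; subst; apply/eval_mu0/IHc.
  by move=> f a n v m H _ _ IH [E]; subst;
    apply: eval_muS (IHc _ _ H) (IH erefl).
Qed.

(** For [m >= 5], [m - 5 = 4 * q + r], where [r] is 0, 1, 2, 3 for [CPair], [CComp], [CRec], [CMu];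
    index 4 is the oracle. The history [h] lists earlier images in descending order, so that of [k]
    is at position [m.-1 - k]. Comparisons are zero tests of truncated differences, the form that
    [cin_if] accepts. *)
Definition subst_step (d m h : nat) : nat :=
  let img k := nfst (iter (m.-1 - k) nsnd h) in
  let q := ((m - 5)./2)./2 in
  let r := m - 5 - 4 * q in
  if 5 - m == 0 then
    if 3 - r == 0 then 8 + 4 * img q
    else 5 + r + 4 * npair (img (nfst q)) (img (nsnd q))
  else if 4 - m == 0 then d else m.

(* [subst_history d n] codes the list of the images of [n - 1, ..., 0] under
   the map that [oracle_subst] induces on indices ([d] being the index of the
   substituted program): a course-of-values recursion. *)
Fixpoint subst_history (d n : nat) : nat :=
  if n is m.+1 then
    npair (subst_step d m (subst_history d m)) (subst_history d m)
  else 0.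

Definition subst_index d n := nfst (subst_history d n.+1).

Lemma subst_historyP d n k : k < n ->
  nfst (iter (n.-1 - k) nsnd (subst_history d n)) = subst_index d k.
Proof.
elim: n => // n IH; rewrite ltnS leq_eqVlt => /predU1P[->|kn].
  by rewrite subnn.
rewrite -(IH kn); have -> : n.+1.-1 - k = (n.-1 - k).+1 by lia.
by rewrite iterSr /= nsnd_pair.
Qed.

Lemma subst_indexE d m :
  let q := ((m - 5)./2)./2 in
  let r := m - 5 - 4 * q in
  subst_index d m =
    if 5 - m == 0 then
      if 3 - r == 0 then 8 + 4 * subst_index d q
      else 5 + r + 4 * npair (subst_index d (nfst q)) (subst_index d (nsnd q))
    else if 4 - m == 0 then d else m.
Proof.
move=> q r; rewrite {1}/subst_index; cbn [subst_history].
rewrite nfst_pair /subst_step.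
have [m5|m5] := ltnP m 5; first by have -> : (5 - m == 0) = false by lia.
have -> : (5 - m == 0) = true by lia.
have qm : q < m by rewrite /q; lia.
have := npair_ge (nfst q) (nsnd q); rewrite npairK => leq.
by rewrite -/q !subst_historyP //; lia.
Qed.

Lemma subst_index_node d q r : r < 3 ->
  subst_index d (5 + r + 4 * q) =
  5 + r + 4 * npair (subst_index d (nfst q)) (subst_index d (nsnd q)).
Proof.
move=> r3; rewrite subst_indexE.
have -> : ((5 + r + 4 * q - 5)./2)./2 = q by lia.
have -> : 5 + r + 4 * q - 5 - 4 * q = r by lia.
have -> : (5 - (5 + r + 4 * q) == 0) = true by lia.
by have -> : (3 - r == 0) = false by lia.
Qed.

Lemma subst_index_mu d q :
  subst_index d (8 + 4 * q) = 8 + 4 * subst_index d q.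
Proof.
rewrite subst_indexE.
have -> : ((8 + 4 * q - 5)./2)./2 = q by lia.
have -> : (3 - (8 + 4 * q - 5 - 4 * q) == 0) = true by lia.
by have -> : (5 - (8 + 4 * q) == 0) = true by lia.
Qed.

Lemma subst_index_encode d c :
  subst_index (encode d) (encode c) = encode (oracle_subst d c).
Proof.
elim: c => [|||||c IHc e IHe|c IHc e IHe|c IHc e IHe|c IHc];
  cbn [encode oracle_subst]; try by rewrite subst_indexE.
- by rewrite (subst_index_node _ _ (r := 0)) // nfst_pair nsnd_pair IHc IHe.
- by rewrite (subst_index_node _ _ (r := 1)) // nfst_pair nsnd_pair IHc IHe.
- by rewrite (subst_index_node _ _ (r := 2)) // nfst_pair nsnd_pair IHc IHe.
- by rewrite subst_index_mu IHc.
Qed.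

Lemma cin_subst_index A d : computable_in A (subst_index d).
Proof.
apply/cin_fst/(cin_comp (F := subst_history d)); last by auto with cin.
apply: (cin_rec (R := fun=> subst_history d) (F := fun=> 0)
  (G := fun _ m h => npair (subst_step d m h) h)) (cin_id _) (cin_id _) => //.
  by auto with cin.
by rewrite /subst_step; auto 20 with cin.
Qed.

(** A program with oracle [A] behaves as its substituted version does with oracle [B], and
    [subst_index] computes the index of the latter. *)
Lemma turing_jump_le A B :
  turing_le A B -> turing_le (turing_jump A) (turing_jump B).
Proof.
(* Decoding is obtained by choice; only the map on indices has to be computable. *)
move=> [d Bd]; pose decode n := projT1 (cid (encode_surj n)).
have decodeK n : encode (decode n) = n by rewrite /decode; case: cid.
apply: (turing_le_jumpP (F := fun e => oracle_subst d (decode e))).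
  apply: cin_ext (cin_subst_index _ (encode d)) => e.
  by rewrite -{1}(decodeK e) subst_index_encode.
move=> e; split=> [[c [y [<- H]]]|[y H]].
  exists y; rewrite (encode_inj (decodeK (encode c))).
  exact: eval_oracle_subst Bd H.
by exists (decode e), y; split=> //; apply: eval_oracle_substV H.
Qed.

(** * Arithmetical sets are recursive in a finite jump *)

Definition jumps (n : nat) : set nat := iter n turing_jump set0.

Lemma turing_le_jumps m n : m <= n -> turing_le (jumps m) (jumps n).
Proof.
elim: n => [|n IH]; first by case: m => // _; exact: turing_le_refl.
rewrite leq_eqVlt => /predU1P[->|/IH mn]; first exact: turing_le_refl.
exact: turing_le_trans mn (turing_le_jump _).
Qed.

(* [None] stands for the term 0. *)
Definition rename_lift (xi : nat -> option nat) (i : nat) : option nat :=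
  if i is j.+1 then omap succn (xi j) else Some 0.

Fixpoint rename_term (xi : nat -> option nat) (t : term) : term :=
  match t with
  | TVar i => oapp TVar TZero (xi i)
  | TZero => TZero
  | TSucc t => TSucc (rename_term xi t)
  | TAdd t u => TAdd (rename_term xi t) (rename_term xi u)
  | TMul t u => TMul (rename_term xi t) (rename_term xi u)
  end.

Fixpoint rename (xi : nat -> option nat) (f : formula) : formula :=
  match f with
  | FEq t u => FEq (rename_term xi t) (rename_term xi u)
  | FNot f => FNot (rename xi f)
  | FAnd f g => FAnd (rename xi f) (rename xi g)
  | FEx f => FEx (rename (rename_lift xi) f)
  end.

Lemma term_val_rename xi r s t :
  (forall i, oapp (nth 0 r) 0 (xi i) = nth 0 s i) ->
  term_val r (rename_term xi t) = term_val s t.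
Proof.
by move=> xiP; elim: t => [i||t /= ->|t /= -> u ->|t /= -> u ->] //=;
  rewrite -xiP; case: (xi i).
Qed.

Lemma sat_rename xi r s f :
  (forall i, oapp (nth 0 r) 0 (xi i) = nth 0 s i) ->
  sat r (rename xi f) <-> sat s f.
Proof.
elim: f xi r s => [t u|f IH|f IHf g IHg|f IH] xi r s xiP /=.
- by rewrite !(term_val_rename _ xiP).
- by rewrite (IH _ _ _ xiP).
- by rewrite (IHf _ _ _ xiP) (IHg _ _ _ xiP).
- have lift n i : oapp (nth 0 (n :: r)) 0 (rename_lift xi i) = nth 0 (n :: s) i.
    by case: i => //= i; rewrite -xiP; case: (xi i).
  by split=> -[n Hn]; exists n; move: Hn; rewrite (IH _ _ _ (lift n)).
Qed.

(** Both sides are equivalent to the truth of [rename Some f] in [r]. Trailing zeros of an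
    environment are thus invisible. *)
Lemma eq_sat r s f : nth 0 r =1 nth 0 s -> sat r f <-> sat s f.
Proof. move=> rs; have := sat_rename (xi := Some) f rs.
by rewrite (sat_rename (s := r)). Qed.

(** * Coding environments by numbers *)

Definition env_code : seq nat -> nat := foldr npair 0.

Lemma env_code_surj n : exists r, env_code r = n.
Proof.
elim/ltn_ind: n => -[_|n IH]; first by exists [::].
(* The second component of a positive number is strictly smaller than it. *)
have [|r Er] := IH (nsnd n.+1).
  have := npair_double (nfst n.+1) (nsnd n.+1); rewrite npairK; nia.
by exists (nfst n.+1 :: r); rewrite /= -/env_code Er npairK.
Qed.

(** Since [npair 0 0 = 0], codes determine environments only up to trailing zeros; an arbitrary
    preimage is chosen, and [nth_env] shows that its entries depend on [n] alone. *)
Definition env (n : nat) : seq nat := projT1 (cid (env_code_surj n)).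

Lemma nfst_iter_nsnd0 i : nfst (iter i nsnd 0) = 0.
Proof.
have n0 : npair 0 0 = 0 by have := npair_double 0 0; lia.
suff -> : iter i nsnd 0 = 0 by rewrite -{1}n0 nfst_pair.
by elim: i => //= i ->; rewrite -{1}n0 nsnd_pair.
Qed.

Lemma nth_env n i : nth 0 (env n) i = nfst (iter i nsnd n).
Proof.
rewrite /env; case: cid => /= r <- {n}; elim: r i => [|x r IH] i.
  by rewrite nth_nil nfst_iter_nsnd0.
case: i => [|i]; first by rewrite /= nfst_pair.
by rewrite iterSr [env_code _]/= nsnd_pair [LHS]/= IH.
Qed.

Lemma nth_env_pair m n : nth 0 (env (npair m n)) =1 nth 0 (m :: env n).
Proof.
case=> [|i]; rewrite nth_env ?iterSr /= ?nfst_pair // nth_env.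
by rewrite nsnd_pair.
Qed.

Lemma cin_term_val A t : computable_in A (fun n => term_val (env n) t).
Proof.
elim: t => [i||t IH|t IHt u IHu|t IHt u IHu] /=; auto with cin.
by apply: cin_ext (fun n => esym (nth_env n i)) _; auto with cin.
Qed.

(** Consing onto an environment is pairing on codes, so each quantifier is an instance of
    [turing_le_ex] and costs one jump. *)
Lemma sat_turing_le_jumps f :
  exists n, turing_le [set e | sat (env e) f] (jumps n).
Proof.
elim: f => [t u|f [n IH]|f [m IHf] g [n IHg]|f [n IH]].
- exists 0; pose T n := term_val (env n) t; pose U n := term_val (env n) u.
  have := cin_term_val (jumps 0) t; have := cin_term_val (jumps 0) u.
  rewrite -/T -/U => HU HT.
  (* Two numbers agree exactly when both truncated differences vanish. *)
  have : computable_in (jumps 0)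
    (fun n => if (T n - U n) + (U n - T n) == 0 then 1 else 0) by auto with cin.
  apply: cin_ext => e /=; rewrite -/(T e) -/(U e).
  by case: asboolP => H; case: eqP => //; lia.
- by exists n; exact: turing_le_not IH.
- exists (maxn m n); apply: turing_le_and.
    by apply: turing_le_trans IHf (turing_le_jumps _); rewrite leq_maxl.
  by apply: turing_le_trans IHg (turing_le_jumps _); rewrite leq_maxr.
- exists n.+1; apply: turing_le_trans (turing_le_ex IH).
  apply: (turing_le_many_one (F := id)) (cin_id _) _ => e /=.
  by split=> -[k Hk]; exists k; move: Hk; rewrite (eq_sat _ (nth_env_pair k e)).
Qed.

Lemma arithmetical_le_jumps A :
  arithmetical A -> exists n, turing_le A (jumps n).
Proof.
move=> [f Af]; have [n Hn] := sat_turing_le_jumps f; exists n.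
(* [npair x 0] codes [[:: x]] up to trailing zeros. *)
apply: turing_le_trans Hn; apply: (turing_le_many_one (F := npair^~ 0)).
  by auto with cin.
move=> x; rewrite Af /= (eq_sat _ (nth_env_pair x 0)).
by apply: eq_sat => -[|i] //=; rewrite nth_env nfst_iter_nsnd0 nth_nil.
Qed.

(** * Arithmetical definability *)

Definition definable (R : seq nat -> Prop) : Prop :=
  exists f, forall r, R r <-> sat r f.

(* A function of the environment is definable when its graph is, the value
   being passed as variable 0. *)
Definition fun_definable (F : seq nat -> nat) : Prop :=
  definable (fun r => F (behead r) = nth 0 r 0).

Lemma definable_ext R R' :
  (forall r, R r <-> R' r) -> definable R -> definable R'.
Proof. by move=> RR' [f Hf]; exists f => r; rewrite -RR'. Qed.

Lemma definable_not R : definable R -> definable (fun r => ~ R r).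
Proof. by move=> [f Hf]; exists (FNot f) => r; rewrite Hf. Qed.

Lemma definable_and R S :
  definable R -> definable S -> definable (fun r => R r /\ S r).
Proof. by move=> [f Hf] [g Hg]; exists (FAnd f g) => r; rewrite Hf Hg. Qed.

Lemma definable_or R S :
  definable R -> definable S -> definable (fun r => R r \/ S r).
Proof.
move=> HR HS; have := definable_not
  (definable_and (definable_not HR) (definable_not HS)).
apply: definable_ext => r; split; last by tauto.
by move=> H; apply: contrapT; tauto.
Qed.

Lemma definable_imp R S :
  definable R -> definable S -> definable (fun r => R r -> S r).
Proof.
move=> HR HS; have := definable_not (definable_and HR (definable_not HS)).
apply: definable_ext => r; split; last by tauto.
by move=> H Rr; apply: contrapT; tauto.
Qed.

(** The bound value is kept apart from the environment: in the premise it becomes variable 0, and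
    older variables are reached through one more [behead]. *)
Lemma definable_ex (R : seq nat -> nat -> Prop) :
  definable (fun r => R (behead r) (nth 0 r 0)) ->
  definable (fun r => exists n, R r n).
Proof.
by move=> [f Hf]; exists (FEx f) => r; split=> -[n Hn]; exists n;
  have := Hf (n :: r) => /= E; apply/E.
Qed.

Lemma definable_all (R : seq nat -> nat -> Prop) :
  definable (fun r => R (behead r) (nth 0 r 0)) ->
  definable (fun r => forall n, R r n).
Proof.
move=> HR; have := definable_not (definable_ex (R := fun r n => ~ R r n)
  (definable_not HR)).
apply: definable_ext => r; split=> [H n|H [n /(_ (H n))//]].
by apply: contrapT => Rn; apply: H; exists n.
Qed.

Lemma definable_comp R (h : seq nat -> seq nat) xi :
  (forall r i, oapp (nth 0 r) 0 (xi i) = nth 0 (h r) i) ->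
  definable R -> definable (fun r => R (h r)).
Proof.
by move=> hxi [f Hf]; exists (rename xi f) => r;
  rewrite Hf (sat_rename _ (hxi r)).
Qed.

Lemma fun_definable_shift F k :
  fun_definable F -> fun_definable (fun r => F (iter k behead r)).
Proof.
have nth_iter r i : nth 0 (iter k behead r) i = nth 0 r (k + i).
  by elim: k i => //= k IH i; rewrite nth_behead IH addnS.
(* Variable 0 holds the value of the function and stays; all others move past [k] new binders. *)
apply: (definable_comp (h := fun r => nth 0 r 0 :: iter k behead (behead r))
  (xi := fun i => Some (if i is j.+1 then (k + j).+1 else 0))).
move=> r [|i] //=; rewrite -nth_behead.
by have := nth_iter (behead r) i.
Qed.

Lemma fun_definable_nth i : fun_definable (nth 0 ^~ i).
Proof. by exists (FEq (TVar i.+1) (TVar 0)) => r /=; rewrite nth_behead. Qed.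

Lemma definable_eq F G :
  fun_definable F -> fun_definable G -> definable (fun r => F r = G r).
Proof.
move=> HF HG.
have := definable_ex (R := fun r z => F r = z /\ G r = z) (definable_and HF HG).
by apply: definable_ext => r; split=> [[z [-> ->]]|->] //; exists (G r).
Qed.

Lemma definable_set (A : set nat) F : arithmetical A -> fun_definable F ->
  definable (fun r => A (F r)).
Proof.
move=> [f Hf] HF.
have HA : definable (fun r => A (nth 0 r 0)).
  (* All variables but the first are replaced by the term 0, matching the one-entry environment in
     [arithmetical]. *)
  exists (rename (fun i => if i is 0 then Some 0 else None) f) => r.
  rewrite Hf (sat_rename _ (s := [:: nth 0 r 0])) // => -[|i] //=.
  by rewrite nth_nil.
have := definable_ex (R := fun r z => F r = z /\ A z) (definable_and HF HA).
by apply: definable_ext => r; split=> [[z [-> //]]|AF]; exists (F r).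
Qed.

Lemma fun_definable_op (op : nat -> nat -> nat) F G :
  definable (fun r => op (nth 0 r 1) (nth 0 r 0) = nth 0 r 2) ->
  fun_definable F -> fun_definable G ->
  fun_definable (fun r => op (F r) (G r)).
Proof.
move=> Hop HF HG.
have H : definable (fun r => exists u, F (behead r) = u /\
    exists v, G (behead r) = v /\ op u v = nth 0 r 0).
  (* [F] lies under the value and [u], and [G] also under [v], hence the shifts by 2 and 3. *)
  apply: definable_ex; apply: definable_and.
    by apply: definable_eq;
      [exact: (fun_definable_shift 2 HF)|exact: fun_definable_nth].
  apply: definable_ex; apply: definable_and.
    by apply: definable_eq;
      [exact: (fun_definable_shift 3 HG)|exact: fun_definable_nth].
  by apply: definable_ext Hop => r; rewrite !nth_behead.
apply: definable_ext H => r; split=> [[u [<- [v [<- //]]]]|E].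
by exists (F (behead r)); split=> //; exists (G (behead r)).
Qed.

Lemma fun_definable_add F G : fun_definable F -> fun_definable G ->
  fun_definable (fun r => F r + G r).
Proof.
by apply: fun_definable_op; exists (FEq (TAdd (TVar 1) (TVar 0)) (TVar 2)).
Qed.

Lemma fun_definable_mul F G : fun_definable F -> fun_definable G ->
  fun_definable (fun r => F r * G r).
Proof.
by apply: fun_definable_op; exists (FEq (TMul (TVar 1) (TVar 0)) (TVar 2)).
Qed.

Lemma fun_definable_pair F G : fun_definable F -> fun_definable G ->
  fun_definable (fun r => npair (F r) (G r)).
Proof.
apply: fun_definable_op; pose s := TAdd (TVar 1) (TVar 0).
(* Doubling turns the Cantor pairing into a polynomial, which avoids a division by 2. *)
exists (FEq (TAdd (TVar 2) (TVar 2))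
            (TAdd (TAdd (TVar 0) (TVar 0)) (TMul s (TSucc s)))) => r /=.
by rewrite -npair_double; lia.
Qed.

Lemma fun_definable_const n : fun_definable (fun=> n).
Proof.
exists (FEq (iter n TSucc TZero) (TVar 0)) => r /=.
by have -> : term_val r (iter n TSucc TZero) = n by elim: n => //= n ->.
Qed.

Lemma fun_definable_succ F :
  fun_definable F -> fun_definable (fun r => (F r).+1).
Proof. by move=> HF; apply: (fun_definable_add (fun_definable_const 1) HF). Qed.

(** The listed shifts cover the quantifier depths at which parameters and bound variables occur in
    the formulas below. *)
Ltac fun_definability :=
  first
  [ exact: fun_definable_const
  | exact: fun_definable_nth
  | match goal with H : fun_definable ?F |- _ => first
    [ exact: (@fun_definable_shift F 0 H) | exact: (@fun_definable_shift F 1 H)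
    | exact: (@fun_definable_shift F 2 H) | exact: (@fun_definable_shift F 3 H)
    | exact: (@fun_definable_shift F 4 H) | exact: (@fun_definable_shift F 5 H)
    | exact: (@fun_definable_shift F 6 H) | exact: (@fun_definable_shift F 7 H)]
    end
  | let H := constr:(fun_definable_nth 0) in first
    [ exact: (fun_definable_shift 1 H) | exact: (fun_definable_shift 2 H)
    | exact: (fun_definable_shift 3 H) | exact: (fun_definable_shift 4 H)
    | exact: (fun_definable_shift 5 H) | exact: (fun_definable_shift 6 H)]
  | apply: fun_definable_succ; fun_definability
  | apply: fun_definable_pair; fun_definability
  | apply: fun_definable_add; fun_definability
  | apply: fun_definable_mul; fun_definability ].

(** Recursion on the shape of the predicate; [tac] treats atoms other than equations. *)
Ltac definability_with tac :=
  first
  [ tac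
  | apply: definable_eq; fun_definability
  | apply: definable_and; definability_with tac
  | apply: definable_or; definability_with tac
  | apply: definable_not; definability_with tac
  | apply: definable_ex; definability_with tac
  | apply: definable_all; definability_with tac
  | apply: definable_imp; definability_with tac ].

(** * Coding finite sets of numbers *)

(* [b] will be a factorial large enough for the moduli [1 + k.+1 * b] with
   [k < N] to be pairwise coprime. *)
Definition fin_mem (N a b k : nat) : Prop :=
  (exists i, N = k + i.+1) /\ exists q, a = q * (k.+1 * b).+1.

Lemma fin_memP N a b k : fin_mem N a b k <-> k < N /\ (k.+1 * b).+1 %| a.
Proof.
split=> [[[i ->] [q ->]]|[kN /dvdnP aq]].
  by rewrite dvdn_mull ?dvdnn; split=> //; lia.
by split=> //; exists (N - k.+1); lia.
Qed.

(** A common divisor divides a combination of the moduli equal to [j - i], hence the factorial of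
    [N], hence 1. *)
Lemma coprime_moduli N i j : i < j < N ->
  coprime (i.+1 * N`!).+1 (j.+1 * N`!).+1.
Proof.
move=> /andP[ij jN]; rewrite /coprime; set g := gcdn _ _.
have gi : g %| (i.+1 * N`!).+1 := dvdn_gcdl _ _.
have gj : g %| (j.+1 * N`!).+1 := dvdn_gcdr _ _.
have gN : g %| N`!.
  apply: (@dvdn_trans (j - i)); last by apply: dvdn_fact; lia.
  have -> : j - i = j.+1 * (i.+1 * N`!).+1 - i.+1 * (j.+1 * N`!).+1 by nia.
  by rewrite dvdn_sub ?dvdn_mull.
by rewrite -dvdn1 -(dvdn_addr 1 (dvdn_mull i.+1 gN)) addn1.
Qed.

(** Take for [a] the product of the moduli of the members; the modulus of a nonmember below [N] is
    coprime to it and exceeds 1. *)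
Lemma fin_mem_code (l : seq nat) :
  exists N a b, forall k, fin_mem N a b k <-> k \in l.
Proof.
pose N := (\max_(k <- l) k).+1; pose m k := (k.+1 * N`!).+1.
have lN k : k \in l -> k < N.
  by move=> kl; rewrite ltnS (leq_bigmax_seq (F := id)).
exists N, (\prod_(k <- l) m k), N`! => k; rewrite fin_memP -/(m k).
split=> [[kN mk]|kl]; last first.
  by split; [exact: lN|rewrite (big_rem _ kl) /= dvdn_mulr].
apply: contraTT mk => kl.
have cop : coprime (m k) (\prod_(j <- l) m j).
  rewrite coprime_sym big_seq.
  apply: (big_ind (coprime^~ (m k))) => [|x y cx cy|j jl].
  - exact: coprime1n.
  - by rewrite coprimeMl cx.
  - have := lN j jl; have [jk|kj|jk] := ltngtP j k => jN.
    + by apply: coprime_moduli; lia.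
    + by rewrite coprime_sym; apply: coprime_moduli; lia.
    + by rewrite jk (negbTE kl) in jl.
apply/negP => /gcdn_idPl mk.
move: cop; rewrite /coprime mk /m eqSS muln_eq0 /=.
by have := fact_gt0 N; lia.
Qed.

(** * Arithmetization of the evaluation relation *)

(* [rule A S e x y]: the statement "program number e maps x to y" follows by
   one rule of [eval A] from statements in [S]. *)
Definition rule (A : set nat) (S : nat -> nat -> nat -> Prop) (e x y : nat) :=
  (e = 0 /\ y = 0) \/ (e = 1 /\ y = x.+1) \/
  (e = 2 /\ exists z, x = npair y z) \/ (e = 3 /\ exists z, x = npair z y) \/
  (e = 4 /\ (A x /\ y = 1 \/ ~ A x /\ y = 0)) \/
  (exists c d, e = 5 + 4 * npair c d /\
    exists u v, y = npair u v /\ S c x u /\ S d x v) \/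
  (exists c d, e = 6 + 4 * npair c d /\ exists u, S d x u /\ S c u y) \/
  (exists c d, e = 7 + 4 * npair c d /\ exists a n, x = npair a n /\
    (n = 0 /\ S c a y \/
     exists m u, n = m.+1 /\ S e (npair a m) u /\
                 S d (npair a (npair m u)) y)) \/
  (exists c, e = 8 + 4 * c /\ exists a n, x = npair a n /\
    (y = n /\ S c x 0 \/
     exists v, S c x v.+1 /\ S e (npair a n.+1) y)).

(** [S] occurs only positively. This allows derivations to be merged and lists to be exchanged for
    their numerical codes. *)
Lemma rule_mono A (S S' : nat -> nat -> nat -> Prop) e x y :
  (forall e x y, S e x y -> S' e x y) -> rule A S e x y -> rule A S' e x y.
Proof.
move=> SS'; do 5 (case=> [H|]; first by rewrite /rule; tauto).
move=> H; do 5 right; move: H.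
case=> [[c [d [E [u [v [yE [Sc Sd]]]]]]]|H]; [left|right; move: H].
  by exists c, d; split=> //; exists u, v; auto.
case=> [[c [d [E [u [Sd Sc]]]]]|H]; [left|right; move: H].
  by exists c, d; split=> //; exists u; auto.
case=> [[c [d [E [a [n [xE H]]]]]]|[c [E [a [n [xE H]]]]]]; [left|right].
  exists c, d; split=> //; exists a, n; split=> //.
  by case: H => [[]|[m [u [? []]]]]; [left|right; exists m, u]; auto.
exists c; split=> //; exists a, n; split=> //.
by case: H => [[]|[v []]]; [left|right; exists v]; auto.
Qed.

(** [rule] mentions only numbers, so that it can be written in arithmetic; this counterpart matches
    on the program, as inductions require. *)
Definition code_rule (A : set nat) (S : nat -> nat -> nat -> Prop)
    (c : code) (x y : nat) : Prop :=
  let T c := S (encode c) in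
  match c with
  | CZero => y = 0
  | CSucc => y = x.+1
  | CFst => exists z, x = npair y z
  | CSnd => exists z, x = npair z y
  | COracle => A x /\ y = 1 \/ ~ A x /\ y = 0
  | CPair c1 d1 => exists u v, y = npair u v /\ T c1 x u /\ T d1 x v
  | CComp c1 d1 => exists u, T d1 x u /\ T c1 u y
  | CRec c1 d1 => exists a n, x = npair a n /\
      (n = 0 /\ T c1 a y \/
       exists m u, n = m.+1 /\ T c (npair a m) u /\
                   T d1 (npair a (npair m u)) y)
  | CMu c1 => exists a n, x = npair a n /\
      (y = n /\ T c1 x 0 \/
       exists v, T c1 x v.+1 /\ T c (npair a n.+1) y)
  end.

Lemma rule_encode A S c x y :
  rule A S (encode c) x y <-> code_rule A S c x y.
Proof.
split.
  case=> [[E H]|]; first by case: c E => //= *; lia.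
  case=> [[E H]|]; first by case: c E => //= *; lia.
  case=> [[E H]|]; first by case: c E => //= *; lia.
  case=> [[E H]|]; first by case: c E => //= *; lia.
  case=> [[E H]|]; first by case: c E => //= *; lia.
  case=> [[c' [d' [E H]]]|].
    case: c E => [|||||c d|c d|c d|c] E; cbn [encode] in E; try lia.
    have /npair_inj[Ec Ed] : npair (encode c) (encode d) = npair c' d' by lia.
    by rewrite /code_rule Ec Ed.
  case=> [[c' [d' [E H]]]|].
    case: c E => [|||||c d|c d|c d|c] E; cbn [encode] in E; try lia.
    have /npair_inj[Ec Ed] : npair (encode c) (encode d) = npair c' d' by lia.
    by rewrite /code_rule Ec Ed.
  case=> [[c' [d' [E H]]]|[c' [E H]]].
    case: c E H => [|||||c d|c d|c d|c] E H; cbn [encode] in E; try lia.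
    have /npair_inj[Ec Ed] : npair (encode c) (encode d) = npair c' d' by lia.
    by rewrite /code_rule Ec Ed.
  case: c E H => [|||||c d|c d|c d|c] E H; cbn [encode] in E; try lia.
  have Ec : encode c = c' by lia.
  by rewrite /code_rule Ec.
case: c => [|||||c d|c d|c d|c] H.
- by left.
- by right; left.
- by do 2 right; left.
- by do 3 right; left.
- by do 4 right; left.
- by do 5 right; left; exists (encode c), (encode d).
- by do 6 right; left; exists (encode c), (encode d).
- by do 7 right; left; exists (encode c), (encode d).
- by do 8 right; exists (encode c).
Qed.

(* Every chain of premises in [S] is finite: along it the program shrinks,
   except that the second argument of [CRec] decreases and that of [CMu]
   increases, which the bound [N] forbids in the long run. *)
Lemma rule_closed_sound A (S : nat -> nat -> nat -> Prop) N :
  (forall e x y, S e x y -> x < N) ->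
  (forall e x y, S e x y -> rule A S e x y) ->
  forall c x y, S (encode c) x y -> eval A c x y.
Proof.
move=> SN SR c.
have {}SR c' x y : S (encode c') x y -> code_rule A S c' x y.
  by move/SR/rule_encode.
elim: c => [|||||c IHc d IHd|c IHc d IHd|c IHc d IHd|c IHc] x y /[dup] Sxy /SR.
- by move=> /= ->; constructor.
- by move=> /= ->; constructor.
- by move=> /= [z ->]; rewrite -{2}(nfst_pair y z); constructor.
- by move=> /= [z ->]; rewrite -{2}(nsnd_pair z y); constructor.
- by move=> H; have := eval_oracle A x; case: asboolP => Ax;
    case: H => -[] // _ ->.
- by move=> [u [v [-> [/IHc Hc /IHd Hd]]]]; exact: eval_pair.
- by move=> [u [/IHd Hd /IHc Hc]]; exact: eval_comp Hd Hc.
- move=> [a [n [Ex _]]]; rewrite {}Ex in Sxy *.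
  elim: n y Sxy => [|n IH] y /SR[a' [n' [/npair_inj[<- <-]]]].
    by case=> [[_ /IHc]|[m [u []]]] //; exact: eval_rec0.
  case=> [[]|[m [u [[<-] [/IH Hu /IHd Hy]]]]] //.
  exact: eval_recS Hu Hy.
- move=> [a [n [Ex _]]]; rewrite {}Ex in Sxy *.
  (* The counter of a search grows but stays below [N], as [n <= npair a n < N]; so [N - n]
     decreases. *)
  have [k] := ubnP (N - n); elim: k n Sxy => // k IH n Sxy nk.
  have nN : n < N by have := SN _ _ _ Sxy; have := npair_ge a n; lia.
  have [a' [n' [/npair_inj[<- <-]]]] := SR _ _ _ Sxy.
  case=> [[-> /IHc]|[v [/IHc Hv /IH Hy]]]; first exact: eval_mu0.
  by apply: eval_muS Hv (Hy _); lia.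
Qed.

Definition triple_in (l : seq nat) (e x y : nat) : Prop :=
  npair e (npair x y) \in l.

Definition rule_closed A l :=
  forall e x y, triple_in l e x y -> rule A (triple_in l) e x y.

Lemma rule_closed_cat A l1 l2 :
  rule_closed A l1 -> rule_closed A l2 -> rule_closed A (l1 ++ l2).
Proof.
move=> H1 H2 e x y; rewrite {1}/triple_in mem_cat => /orP[/H1|/H2];
  apply: rule_mono => e' x' y'; rewrite /triple_in mem_cat => ->;
  by rewrite ?orbT.
Qed.

Lemma rule_closed_cons A l c x y : rule_closed A l ->
  code_rule A (triple_in l) c x y ->
  rule_closed A (npair (encode c) (npair x y) :: l).
Proof.
move=> Hl /rule_encode Hr e' x' y'; rewrite {1}/triple_in inE => H.
apply: (@rule_mono _ (triple_in l)) => [e1 x1 y1|].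
  by rewrite /triple_in inE => ->; rewrite orbT.
by case/predU1P: H => [/npair_inj[-> /npair_inj[-> ->]]|/Hl].
Qed.

(** The list collects the statements of the evaluation tree: those of the premises, with the
    conclusion put in front. *)
Lemma eval_rule_closed A c x y : eval A c x y ->
  exists l, rule_closed A l /\ triple_in l (encode c) x y.
Proof.
have add c' x' y' l : rule_closed A l -> code_rule A (triple_in l) c' x' y' ->
    exists l, rule_closed A l /\ triple_in l (encode c') x' y'.
  move=> Hl Hr; exists (npair (encode c') (npair x' y') :: l).
  by split; [exact: rule_closed_cons|rewrite /triple_in mem_head].
have catl l1 l2 e' x' y' :
    triple_in l1 e' x' y' -> triple_in (l1 ++ l2) e' x' y'.
  by rewrite /triple_in mem_cat => ->.
have catr l1 l2 e' x' y' :
    triple_in l2 e' x' y' -> triple_in (l1 ++ l2) e' x' y'.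
  by rewrite /triple_in mem_cat orbC => ->.
have nilP : rule_closed A [::] by [].
elim=> {c x y}.
- by move=> x; apply: (add _ _ _ [::]).
- by move=> x; apply: (add _ _ _ [::]).
- by move=> x; apply: (add _ _ _ [::]) => //; exists (nsnd x); rewrite npairK.
- by move=> x; apply: (add _ _ _ [::]) => //; exists (nfst x); rewrite npairK.
- move=> x; apply: (add _ _ _ [::]) => //=.
  by case: asboolP => Ax; [left|right].
- move=> c d x u v _ [l1 [H1 T1]] _ [l2 [H2 T2]].
  apply: add (rule_closed_cat H1 H2) _; exists u, v.
  by split=> //; split; [exact: catl|exact: catr].
- move=> c d x u v _ [l1 [H1 T1]] _ [l2 [H2 T2]].
  apply: add (rule_closed_cat H1 H2) _; exists u.
  by split; [exact: catl|exact: catr].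
- move=> c d a y _ [l [H T]]; apply: add H _; exists a, 0.
  by split=> //; left.
- move=> c d a n y z _ [l1 [H1 T1]] _ [l2 [H2 T2]].
  apply: add (rule_closed_cat H1 H2) _; exists a, n.+1; split=> //; right.
  by exists n, y; split=> //; split; [exact: catl|exact: catr].
- move=> c a n _ [l [H T]]; apply: add H _; exists a, n.
  by split=> //; left.
- move=> c a n v m _ [l1 [H1 T1]] _ [l2 [H2 T2]].
  apply: add (rule_closed_cat H1 H2) _; exists a, n; split=> //; right.
  by exists v; split; [exact: catl|exact: catr].
Qed.

Definition code_triple (N a b e x y : nat) : Prop :=
  fin_mem N a b (npair e (npair x y)).

Lemma eval_arithmetizedP A c x y : eval A c x y <->
  exists N a b,
    (forall e x y, code_triple N a b e x y ->
                   rule A (code_triple N a b) e x y) /\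
    code_triple N a b (encode c) x y.
Proof.
split=> [/eval_rule_closed[l [Hl Hc]]|[N [a [b [HR Hc]]]]].
  have [N [a [b HN]]] := fin_mem_code l; exists N, a, b.
  split; last exact/HN.
  move=> e x' y' /HN/Hl; apply: rule_mono => *; exact/HN.
(* The bound [N] of the coded set also bounds the inputs, since a pair is at least as large as its
   components. *)
apply: (rule_closed_sound (N := N) _ HR) Hc => e x' y' /fin_memP[].
by have := npair_ge e (npair x' y'); have := npair_ge x' y'; lia.
Qed.

(** * Definability of evaluation and closure of the arithmetical sets *)

Lemma definable_code_triple N a b e x y :
  fun_definable N -> fun_definable a -> fun_definable b ->
  fun_definable e -> fun_definable x -> fun_definable y ->
  definable (fun r => code_triple (N r) (a r) (b r) (e r) (x r) (y r)).
Proof. by move=> *; rewrite /code_triple /fin_mem; definability_with fail. Qed.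

Lemma definable_rule A N a b e x y : arithmetical A ->
  fun_definable N -> fun_definable a -> fun_definable b ->
  fun_definable e -> fun_definable x -> fun_definable y ->
  definable (fun r => rule A (code_triple (N r) (a r) (b r)) (e r) (x r) (y r)).
Proof.
move=> HA *; rewrite /rule; definability_with ltac:(first
  [ apply: (definable_set HA); fun_definability
  | apply: definable_code_triple; fun_definability ]).
Qed.

(** The index may vary with the environment, as the jump requires; every number being an index, the
    program is always available. *)
Lemma definable_eval A e x y : arithmetical A ->
  fun_definable e -> fun_definable x -> fun_definable y ->
  definable (fun r => exists c, encode c = e r /\ eval A c (x r) (y r)).
Proof.
move=> HA He Hx Hy.
have H : definable (fun r => exists N a b,
    (forall e x y, code_triple N a b e x y ->
                   rule A (code_triple N a b) e x y) /\
    code_triple N a b (e r) (x r) (y r)).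
  definability_with ltac:(first
    [ apply: (definable_rule HA); fun_definability
    | apply: definable_code_triple; fun_definability ]).
apply: definable_ext H => r; split; last by move=> [c [<- /eval_arithmetizedP]].
move=> [N [a [b H]]].
have [c Ec] := encode_surj (e r); exists c; split=> //.
by apply/eval_arithmetizedP; exists N, a, b; rewrite Ec.
Qed.

Lemma arithmetical_definable A :
  definable (fun r => A (nth 0 r 0)) -> arithmetical A.
Proof. by move=> [f Hf]; exists f => n; apply: (Hf [:: n]). Qed.

(** [A] consists of the inputs on which the reducing program outputs 1; determinism excludes this
    output outside [A]. *)
Lemma arithmetical_turing_le A B :
  turing_le A B -> arithmetical B -> arithmetical A.
Proof.
move=> [c Hc] HB; apply: arithmetical_definable.
have := definable_eval HB (fun_definable_const (encode c))
  (fun_definable_nth 0) (fun_definable_const 1).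
apply: definable_ext => r; split=> [[d [/encode_inj-> H]]|AF].
  by have := eval_det H (Hc _); case: asboolP.
by exists c; split=> //; have := Hc (nth 0 r 0); case: asboolP.
Qed.

Lemma arithmetical_jump A : arithmetical A -> arithmetical (turing_jump A).
Proof.
move=> HA; apply: arithmetical_definable.
have H : definable (fun r => exists y, exists c, encode c = nth 0 r 0 /\
    eval A c (nth 0 r 0) y).
  apply: definable_ex; apply: definable_eval => //; fun_definability.
apply: definable_ext H => r; split=> [[y [c H]]|[c [y H]]].
  by exists c, y.
by exists y, c.
Qed.

Lemma arithmeticalP A : arithmetical A <-> exists n, turing_le A (jumps n).
Proof.
split=> [|[n An]]; first exact: arithmetical_le_jumps.
apply: arithmetical_turing_le An _; elim: n => [|n IH].
  by exists (FNot (FEq TZero TZero)) => n; split=> // /(_ erefl).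
exact: arithmetical_jump.
Qed.

(** * Degrees *)

Lemma degree_le_trans a b c : degree_le a b -> degree_le b c -> degree_le a c.
Proof. exact: turing_le_trans. Qed.

(** Independence of the representative, by monotonicity of the jump on sets. *)
Lemma degree_jump_deg A : degree_jump (deg A) = deg (turing_jump A).
Proof.
have /degP[H1 H2] : deg (degree_repr (deg A)) = deg A by rewrite degree_reprK.
by apply/degP; split; exact: turing_jump_le.
Qed.

Lemma zero_jumpE n : zero_jump n = deg (jumps n).
Proof. by elim: n => //= n ->; rewrite degree_jump_deg. Qed.

Lemma degree_jump_le a b :
  degree_le a b -> degree_le (degree_jump a) (degree_jump b).
Proof. by move=> ab; apply/degree_leE/turing_jump_le. Qed.

Lemma degree_le_joinl a b : degree_le a (degree_join a b).
Proof. by rewrite -{1}(degree_reprK a); apply/degree_leE/turing_le_joinl. Qed.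

Lemma degree_le_joinr a b : degree_le b (degree_join a b).
Proof. by rewrite -{1}(degree_reprK b); apply/degree_leE/turing_le_joinr. Qed.

Lemma degree_join_le a b c :
  degree_le a c -> degree_le b c -> degree_le (degree_join a b) c.
Proof.
move=> ac bc; rewrite -(degree_reprK c); apply/degree_leE.
exact: turing_join_le.
Qed.

(** * The arithmetical degrees as least fixed point *)

Lemma ARITH_zero_jump :
  ARITH = \bigcup_(n in [set: nat]) lower_cone (zero_jump n).
Proof.
apply/seteqP; split=> [_ [A /arithmeticalP[n An] <-]|a [n _ an]].
  by exists n => //; rewrite /lower_cone /= zero_jumpE; apply/degree_leE.
exists (degree_repr a); last exact: degree_reprK.
apply/arithmeticalP; exists n; apply/degree_leE.
by rewrite degree_reprK -zero_jumpE.
Qed.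

Lemma Gamma_ideal I : turing_ideal I -> turing_ideal (Gamma I).
Proof.
move=> [[a Ia] _ Ijoin]; split.
- exists (degree_jump a), (degree_jump a); first by exists a.
  exact: turing_le_refl.
- move=> b c [s Is bs] cb; exists s => //; exact: degree_le_trans cb bs.
- move=> b c [_ [s Is <-] bs] [_ [t It <-] ct].
  (* The jump of the join bounds both jumps. *)
  exists (degree_jump (degree_join s t)).
    by exists (degree_join s t) => //; exact: Ijoin.
  apply: degree_join_le.
    exact: degree_le_trans bs (degree_jump_le (degree_le_joinl s t)).
  exact: degree_le_trans ct (degree_jump_le (degree_le_joinr s t)).
Qed.

Lemma zero_jump_le m n : m <= n -> degree_le (zero_jump m) (zero_jump n).
Proof. by move=> mn; rewrite !zero_jumpE; apply/degree_leE/turing_le_jumps. Qed.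

Lemma ARITH_ideal : turing_ideal ARITH.
Proof.
rewrite ARITH_zero_jump; split.
- by exists (zero_jump 0), 0 => //; exact: turing_le_refl.
- move=> a b [n _ an] ba; exists n => //; exact: degree_le_trans ba an.
- move=> a b [m _ am] [n _ bn]; exists (maxn m n) => //; apply: degree_join_le.
    by apply: degree_le_trans am (zero_jump_le _); rewrite leq_maxl.
  by apply: degree_le_trans bn (zero_jump_le _); rewrite leq_maxr.
Qed.

Lemma Gamma_ARITH : Gamma ARITH = ARITH.
Proof.
rewrite ARITH_zero_jump; apply/seteqP; split.
  move=> b [_ [a [n _ an] <-] ba]; exists n.+1 => //.
  exact: degree_le_trans ba (degree_jump_le an).
(* A degree below the [n]-th jump of zero is also below the next one, which is the jump of a
   member. *)
move=> b [n _ bn]; exists (zero_jump n.+1).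
  by exists (zero_jump n) => //; exists n => //; exact: turing_le_refl.
exact: degree_le_trans bn (zero_jump_le (leqnSn n)).
Qed.

(** By induction [I] contains every finite jump of zero: the least degree by downward closure, each
    next jump because [I] equals [Gamma I]. *)
Lemma ARITH_least I : turing_ideal I -> Gamma I = I -> ARITH `<=` I.
Proof.
move=> [[a Ia] Idown _] GI; rewrite ARITH_zero_jump => b [n _ bn].
apply: (Idown _ _ _ bn); elim: n {b bn} => [|n IH].
  by apply: (Idown _ _ Ia); rewrite -(degree_reprK a);
    apply/degree_leE/turing_le_set0.
rewrite -GI; exists (zero_jump n.+1); last exact: turing_le_refl.
by exists (zero_jump n).
Qed.

Theorem corollary3p4 :
  (forall I : set degree, turing_ideal I -> turing_ideal (Gamma I)) /\
  ARITH = \bigcup_(n in [set: nat]) lower_cone (zero_jump n) /\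
  turing_ideal ARITH /\
  Gamma ARITH = ARITH /\
  (forall I : set degree, turing_ideal I -> Gamma I = I -> ARITH `<=` I).
Proof.
split; first exact: Gamma_ideal.
split; first exact: ARITH_zero_jump.
split; first exact: ARITH_ideal.
split; first exact: Gamma_ARITH.
exact: ARITH_least.
Qed.
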